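(* Let $t>1$ be odd and $G=\mathbb{Z}_t\times\mathbb{Z}_2^2$ with elements indexed by $\{1,\ldots,4t\}$ so that index $i$ corresponds to $\big(\lfloor (i-1)/4\rfloor,\lfloor [i-1]_4/2\rfloor,[i-1]_2\big)$. Let $\rho$ be the normalized cocycle whose matrix is $$M_\rho=(r_{i,j})=J_t\otimes\begin{pmatrix}1&1&1&1\\1&-1&1&-1\\1&-1&-1&1\\1&1&-1&-1\end{pmatrix},$$ $J_t$ the $t\times t$ all-ones matrix. Let $\mathbb{Q}[X]=\mathbb{Q}[x_1,\ldots,x_{4t-3}]$, where $x_{h-1}$ is associated with the coboundary $\partial_h$, $2\le h\le 4t-2$. Let $\chi(i)=1$ if $2\le i\le 4t-2$ and $\chi(i)=0$ otherwise. For $1\le l\le 2t-2$ and $1\le h\le 4t$ put $$s_{l,h}(X):=r_{l+4,h}\,(1-2x_{h-1})^{\chi(h)}\,(1-2x_{j(l+4,h)-1})^{\chi(j(l+4,h))},$$ where $$j(s,c):=1+4\Big[\Big\lfloor\tfrac{s-1}{4}\Big\rfloor+\Big\lfloor\tfrac{c-1}{4}\Big\rfloor\Big]_t+2\Big[\Big\lfloor\tfrac{[s-1]_4}{2}\Big\rfloor+\Big\lfloor\tfrac{[c-1]_4}{2}\Big\rfloor\Big]_2+[s+c]_2$$ (a factor with exponent $0$ is $1$). Let $$J_{\mathbb{Z}_t\times\mathbb{Z}_2^2}:=\langle x_i^2-x_i: 1\le i\le 4t-3\rangle+\Big\langle \sum_{h=1}^{4t}s_{l,h}(X): 1\le l\le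 2t-2\Big\rangle\subset\mathbb{Q}[X].$$ Then this ideal is zero-dimensional and its variety is exactly the set of $(x_1,\ldots,x_{4t-3})\in\{0,1\}^{4t-3}$ such that the cocyclic matrix of $\psi=\rho\prod_{h=2}^{4t-2}\partial_h^{x_{h-1}}$ is Hadamard; that is, it is in bijection with the set $\mathcal{H}^\rho_{\mathbb{Z}_t\times\mathbb{Z}_2^2}$ of normalized cocyclic Hadamard matrices over $G$ of the form $M_\rho\circ\prod_{h=2}^{4t-2}M_{\partial_h}^{x_{h-1}}$. Moreover $|\mathcal{H}^\rho_{\mathbb{Z}_t\times\mathbb{Z}_2^2}|=\dim_{\mathbb{Q}}(\mathbb{Q}[X]/J_{\mathbb{Z}_t\times\mathbb{Z}_2^2})$.
   Context: $[n]_m$ denotes $n\bmod m$. A normalized cocycle over $G$ is a map $\psi:G\times G\to\{\pm1\}$ with $\psi(g_i,g_j)\psi(g_i+g_j,g_k)=\psi(g_j,g_k)\psi(g_i,g_j+g_k)$ and $\psi(0,g)=\psi(g,0)=1$; its cocyclic matrix is $M_\psi=(\psi(g_i,g_j))$. For $g_d\in G$, $\delta_{g_d}$ is $-1$ at $g_d$ and $1$ elsewhere, and the elementary coboundary is $\partial_d(g_i,g_j)=\delta_{g_d}(g_i)\delta_{g_d}(g_j)\delta_{g_d}(g_i+g_j)$. Cocycles are multiplied pointwise; $\circ$ and products of matrices above denote entrywise (Hadamard) products. The set $\{\partial_2,\ldots,\partial_{4t-2}\}$ together with three representative cocycles (whose product is $\rho$) forms a basis of normalized cocycles over $G$. A Hadamard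 matrix of order $n$ is an $n\times n$ $\pm1$ matrix with $HH^T=nI$. *)

(* Defs.v *)
From HB Require Import structures.
From mathcomp Require Import all_boot all_order all_algebra all_field.
From mathcomp Require Import finmap mpoly mxtens.
From mathcomp Require Import boolp classical_sets functions cardinality.

Set Implicit Arguments.
Unset Strict Implicit.
Unset Printing Implicit Defensive.

Import GRing.Theory.
Local Open Scope ring_scope.
Local Open Scope quotient_scope.

(* Ideals of a commutative ring. Unlike [idealr], the unit ideal is allowed:
   an ideal with empty variety is one of the cases of interest. *)
HB.mixin Record isIdeal (R : comNzRingType) (S : R -> bool) := {
  idealMl : forall a u : R, u \in S -> a * u \in S
}.

#[short(type="ideal")]
HB.structure Definition Ideal (R : comNzRingType) :=
  {S of GRing.ZmodClosed R S & isIdeal R S}.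

Section IdealOps.
Variable R : comNzRingType.

Definition ideal_gen (I : finType) (g : I -> R) : {pred R} :=
  fun p => `[< exists c : I -> R, p = \sum_(i : I) c i * g i >].

Lemma ideal_gen_zmod (I : finType) (g : I -> R) : zmod_closed (ideal_gen g).
Proof.
split=> [|p q /asboolP[c ->] /asboolP[d ->]]; apply/asboolP.
  by exists (fun=> 0); rewrite big1 // => i _; rewrite mul0r.
exists (fun i => c i - d i); rewrite -sumrB.
by apply: eq_bigr => i _; rewrite mulrBl.
Qed.

Lemma ideal_gen_mull (I : finType) (g : I -> R) a u :
  u \in ideal_gen g -> a * u \in ideal_gen g.
Proof.
move=> /asboolP[c ->]; apply/asboolP; exists (fun i => a * c i).
by rewrite mulr_sumr; apply: eq_bigr => i _; rewrite mulrA.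
Qed.

HB.instance Definition _ (I : finType) (g : I -> R) :=
  GRing.isZmodClosed.Build R (ideal_gen g) (ideal_gen_zmod g).
HB.instance Definition _ (I : finType) (g : I -> R) :=
  isIdeal.Build R (ideal_gen g) (@ideal_gen_mull I g).

Definition ideal_add (I J : {pred R}) : {pred R} :=
  fun p => `[< exists u v : R, [/\ u \in I, v \in J & p = u + v] >].

Lemma ideal_add_zmod (I J : ideal R) : zmod_closed (ideal_add I J).
Proof.
split=> [|p q /asboolP[u [v [uI vJ ->]]] /asboolP[u' [v' [uI' vJ' ->]]]].
  by apply/asboolP; exists 0, 0; rewrite !rpred0 addr0.
apply/asboolP; exists (u - u'), (v - v'); rewrite !rpredB //; split=> //.
by rewrite opprD addrACA.
Qed.

Lemma ideal_add_mull (I J : ideal R) a u :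
  u \in ideal_add I J -> a * u \in ideal_add I J.
Proof.
move=> /asboolP[v [w [vI wJ ->]]]; apply/asboolP.
by exists (a * v), (a * w); rewrite !idealMl // mulrDr.
Qed.

HB.instance Definition _ (I J : ideal R) :=
  GRing.isZmodClosed.Build R (ideal_add I J) (ideal_add_zmod I J).
HB.instance Definition _ (I J : ideal R) :=
  isIdeal.Build R (ideal_add I J) (@ideal_add_mull I J).

End IdealOps.

Section QuotientLmodule.
Variables (K : comNzRingType) (A : comAlgType K) (I : ideal A).

Definition quot_module := Quotient.quot I.

HB.instance Definition _ := GRing.Zmodule.on quot_module.

Definition quot_scale (c : K) (q : quot_module) : quot_module :=
  \pi_(Quotient.quot I) (c *: repr q).

Lemma quot_scale_pi (c : K) (p : A) :
  quot_scale c (\pi_(Quotient.quot I) p) = \pi_(Quotient.quot I) (c *: p).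
Proof.
apply/eqP; rewrite -Quotient.idealrBE -scalerBr -mulr_algl idealMl //.
by rewrite Quotient.idealrBE reprK.
Qed.

Lemma quot_piP (v : quot_module) : exists p, v = \pi_(Quotient.quot I) p.
Proof. by exists (repr (v : Quotient.quot I)); rewrite reprK. Qed.

Lemma quot_piD (p q : A) : \pi_(Quotient.quot I) (p + q) =
  (\pi_(Quotient.quot I) p : quot_module) + \pi_(Quotient.quot I) q.
Proof. exact: (raddfD \pi_(Quotient.quot I)). Qed.

Lemma quot_scaleA a b (v : quot_module) :
  quot_scale a (quot_scale b v) = quot_scale (a * b) v.
Proof. by have [p ->] := quot_piP v; rewrite !quot_scale_pi scalerA. Qed.

Lemma quot_scale1 : left_id 1 quot_scale.
Proof. by move=> v; have [p ->] := quot_piP v; rewrite quot_scale_pi scale1r. Qed.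

Lemma quot_scaleDr : right_distributive quot_scale +%R.
Proof.
move=> a u v; have [p ->] := quot_piP u; have [q ->] := quot_piP v.
by rewrite -quot_piD !quot_scale_pi scalerDr quot_piD.
Qed.

Lemma quot_scaleDl (v : quot_module) :
  {morph quot_scale^~ v : a b / a + b}.
Proof.
by move=> a b; have [p ->] := quot_piP v; rewrite !quot_scale_pi scalerDl quot_piD.
Qed.

HB.instance Definition _ := GRing.Zmodule_isLmodule.Build K quot_module
  quot_scaleA quot_scale1 quot_scaleDr quot_scaleDl.

End QuotientLmodule.

Definition has_dim (K : fieldType) (V : lmodType K) (n : nat) : Prop :=
  exists e : 'I_n -> V,
    forall v : V, exists! c : {ffun 'I_n -> K}, v = \sum_(i < n) c i *: e i.

(* Zeros are taken in [algC], an algebraic closure of the rationals, so that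
   finiteness of the variety is the usual notion of zero-dimensionality. *)
Definition variety (n : nat) (I : {pred {mpoly rat[n]}}) : set ('I_n -> algC) :=
  [set v | forall p, p \in I -> (map_mpoly (ratr : rat -> algC) p).@[v] = 0].

Definition zero_dimensional (n : nat) (I : {pred {mpoly rat[n]}}) : Prop :=
  finite_set (variety I).

Section Cocycles.
Variable G : zmodType.
Implicit Types (psi : G -> G -> int) (d a b : G).

Definition normalized_cocycle psi : Prop :=
  [/\ forall a b, psi a b = 1 \/ psi a b = -1,
      forall a b c, psi a b * psi (a + b) c = psi b c * psi a (b + c)
    & forall a, psi 0 a = 1 /\ psi a 0 = 1].

Definition delta d a : int := if a == d then -1 else 1.

Definition coboundary d a b : int := delta d a * delta d b * delta d (a + b).

End Cocycles.

Definition is_hadamard (n : nat) (M : 'M[int]_n) : Prop :=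
  (forall i j, M i j = 1 \/ M i j = -1) /\ M *m M^T = n%:R%:M.

Definition hadamard_prod (m n : nat) (M N : 'M[int]_(m, n)) : 'M[int]_(m, n) :=
  map2_mx *%R M N.

Definition hadamard_pow (m n : nat) (M : 'M[int]_(m, n)) (k : nat) :=
  map_mx (fun a => a ^+ k) M.

(* In what follows [t > 1]; for [t <= 1] the type ['Z_t] is not of order [t]. *)
Definition grp (t : nat) : Type := ('Z_t * ('Z_2 * 'Z_2))%type.
HB.instance Definition _ (t : nat) := GRing.Zmodule.on (grp t).

(* Indices are one-based, ranging over 1, .., 4t. *)
Definition elt (t i : nat) : grp t :=
  (((i - 1) %/ 4)%N%:R, ((((i - 1) %% 4) %/ 2)%N%:R, ((i - 1) %% 2)%N%:R)).

Definition cocyclic_mx (t : nat) (psi : grp t -> grp t -> int) : 'M[int]_(t * 4) :=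
  \matrix_(i < t * 4, j < t * 4) psi (elt t i.+1) (elt t j.+1).

Definition rho_block : 'M[int]_4 :=
  \matrix_(i < 4, j < 4) nth 0 (nth [::]
    [:: [:: 1;  1;  1;  1];
        [:: 1; -1;  1; -1];
        [:: 1; -1; -1;  1];
        [:: 1;  1; -1; -1]] i) j.

Definition M_rho (t : nat) : 'M[int]_(t * 4) :=
  (const_mx 1 : 'M[int]_t) *t rho_block.

(* The zero-based coordinate [x i] stands for x_(h-1) with h = i + 2, the
   exponent of the coboundary at the h-th element of the group. *)
Definition psi (t : nat) (rho : grp t -> grp t -> int)
    (x : {ffun 'I_(4 * t - 3) -> bool}) (a b : grp t) : int :=
  rho a b * \prod_(i < 4 * t - 3) coboundary (elt t i.+2) a b ^+ x i.

Definition form_mx (t : nat) (x : {ffun 'I_(4 * t - 3) -> bool}) :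
    'M[int]_(t * 4) :=
  hadamard_prod (M_rho t)
    (\big[@hadamard_prod _ _/const_mx 1]_(i < 4 * t - 3)
       hadamard_pow (cocyclic_mx (@coboundary (grp t) (elt t i.+2))) (x i)).

Definition cocyclic_hadamard_form (t : nat) : set 'M[int]_(t * 4) :=
  [set M | [/\ exists2 f : grp t -> grp t -> int,
                 normalized_cocycle f & M = cocyclic_mx f,
               is_hadamard M
             & exists x : {ffun 'I_(4 * t - 3) -> bool}, M = form_mx x]].

(* One-based variable x_k; the value outside 1 <= k <= 4t - 3 is irrelevant,
   as it only ever occurs with exponent 0. *)
Definition xvar (t k : nat) : {mpoly rat[4 * t - 3]} :=
  if insub (k - 1)%N : option 'I_(4 * t - 3) is Some i then 'X_i else 0.

Definition chi (t i : nat) : nat := (2 <= i <= 4 * t - 2)%N.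

Definition prod_idx (t s c : nat) : nat :=
  (1 + 4 * (((s - 1) %/ 4 + (c - 1) %/ 4) %% t)
     + 2 * ((((s - 1) %% 4) %/ 2 + ((c - 1) %% 4) %/ 2) %% 2)
     + (s + c) %% 2)%N.

(* [rho (elt t i) (elt t j)] is the (one-based) entry r_(i,j). *)
Definition s_poly (t : nat) (rho : grp t -> grp t -> int) (l h : nat) :
    {mpoly rat[4 * t - 3]} :=
  (rho (elt t (l + 4)) (elt t h))%:~R
    * (1 - 2 * xvar t (h - 1)) ^+ chi t h
    * (1 - 2 * xvar t (prod_idx t (l + 4) h - 1)) ^+ chi t (prod_idx t (l + 4) h).

(* The generators are indexed by l = k + 1 for 0 <= k < 2t - 2. *)
Definition ideal_J (t : nat) (rho : grp t -> grp t -> int) :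
    ideal {mpoly rat[4 * t - 3]} :=
  ideal_add
    (ideal_gen (fun i : 'I_(4 * t - 3) => 'X_i ^+ 2 - 'X_i))
    (ideal_gen (fun k : 'I_(2 * t - 2) =>
       \sum_(1 <= h < (4 * t).+1) s_poly rho k.+1 h)).

Definition bool_point (n : nat) (x : {ffun 'I_n -> bool}) : 'I_n -> algC :=
  fun i => (x i)%:R.

Lemma rho_exists (t : nat) :
  exists2 rho : grp t -> grp t -> int,
    normalized_cocycle rho & cocyclic_mx rho = M_rho t.
Proof.
pose f (u v : 'Z_2 * 'Z_2) : int := nth 0 (nth [::]
    [:: [:: 1;  1;  1;  1];
        [:: 1; -1;  1; -1];
        [:: 1; -1; -1;  1];
        [:: 1;  1; -1; -1]] (2 * u.1 + u.2)) (2 * v.1 + v.2).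
have ZP (P : 'Z_2 * 'Z_2 -> Prop) :
    P (0, 0) -> P (0, 1) -> P (1, 0) -> P (1, 1) -> forall u, P u.
  move=> P00 P01 P10 P11 [u1 u2].
  have Z2 (w : 'Z_2) : w = 0 \/ w = 1.
    by case: w => [[|[|[]]] //] ?; [left|right]; apply: val_inj.
  by case: (Z2 u1) => ->; case: (Z2 u2) => ->.
exists (fun a b => f a.2 b.2).
  split=> [[_ a] [_ b]|[_ a] [_ b] [_ c]|[_ a]] /=.
  - by move: a b; apply: (ZP _); apply: (ZP _); (by left) || by right.
  - by move: a b c; apply: (ZP _); apply: (ZP _); apply: (ZP _).
  - by move: a; apply: (ZP _).
apply/matrixP => i j; case: (mxtens_indexP i) => i1 i2.
case: (mxtens_indexP j) => j1 j2.
rewrite tensmxE !mxE mul1r /elt /= !subn1 /= !modnMDl.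
rewrite -(@modn_dvdm 4 (i1 * 4 + i2)) // -(@modn_dvdm 4 (j1 * 4 + j2)) //.
rewrite !modnMDl.
case: i2 => [[|[|[|[|]]]] //] ?; case: j2 => [[|[|[|[|]]]] //] ?;
by [].
Qed.

(* Main.v *)
(* By the cocycle equation the inner product of two rows a, b of a cocyclic
   matrix is, up to sign, the sum of the row a - b, so the matrix is Hadamard iff
   all rows other than that of 0 sum to zero. The sums of the rows a and - a agree
   up to sign, and the row of an element a of order two with psi(a, a) = -1 sums
   to zero since its entries at b and a + b are opposite; hence the rows
   5, .., 2t + 2 suffice. At a 0/1 point, the polynomial sum_h s_(l,h) is, up to
   sign, the sum of row l + 4.
   The ideal contains X_i^2 - X_i, so modulo it p e_x = p(x) e_x for the indicator
   polynomial e_x of a 0/1 point x. As the e_x sum to 1, those with x in the variety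
   form a basis of the quotient, the other ones lying in the ideal.
   A product of coboundaries determines its exponents because the product of the
   corresponding delta functions is determined up to a homomorphism to {1, -1},
   and, t being odd, such a homomorphism is trivial if it is 1 at the last two
   elements of the group. *)
Require Import Defs.
From HB Require Import structures.
From mathcomp Require Import all_boot all_order all_algebra all_field.
From mathcomp Require Import finmap mpoly mxtens.
From mathcomp Require Import boolp classical_sets functions cardinality.
From mathcomp Require Import zify ring.

Set Implicit Arguments.
Unset Strict Implicit.
Unset Printing Implicit Defensive.

Import GRing.Theory Num.Theory.
Local Open Scope ring_scope.
Local Open Scope classical_set_scope.

(** * Row sums of cocyclic matrices *)

Section NormalizedCocycle.
Variables (G : finZmodType) (f : G -> G -> int).
Hypothesis f_cocycle : normalized_cocycle f.

Lemma cocycle_mulK a b : f a b * f a b = 1.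
Proof. by case: f_cocycle => + _ _ => /(_ a b) [] ->. Qed.

Lemma cocycle_neq0 a b : f a b != 0.
Proof. by case: f_cocycle => + _ _ => /(_ a b) [] ->. Qed.

(** The cocycle equation at (a - b, b, c) writes [f a c] as a sign times
    [f b c * f (a - b) (b + c)]. The factor [f b c] then cancels, and b + c runs over G. *)
Lemma cocycle_row_dot a b :
  \sum_c f a c * f b c = f (a - b) b * \sum_c f (a - b) c.
Proof.
rewrite mulr_sumr [RHS](reindex_inj (addrI b)); apply: eq_bigr => c _ /=.
case: f_cocycle => _ fA _; have := fA (a - b) b c; rewrite subrK => fE.
have -> : f a c = f (a - b) b * (f b c * f (a - b) (b + c)).
  by rewrite -fE mulrA cocycle_mulK mul1r.
by rewrite -mulrA mulrAC cocycle_mulK mul1r.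
Qed.

Lemma cocycle_row_sumN a :
  \sum_b f (- a) b = f (- a) a * \sum_b f a b.
Proof.
rewrite mulr_sumr (reindex_inj (addrI a)); apply: eq_bigr => b _ /=.
case: f_cocycle => _ fA f0; have := fA (- a) a b; rewrite addNr (f0 b).1 mulr1.
by move=> ->; rewrite mulrAC cocycle_mulK mul1r.
Qed.

Lemma cocycle_row_sum_order2 a :
  a + a = 0 -> f a a = -1 -> \sum_b f a b = 0.
Proof.
move=> aa0 faa; suff: \sum_b f a b = - \sum_b f a b by lia.
rewrite -sumrN [LHS](reindex_inj (addrI a)); apply: eq_bigr => b _ /=.
case: f_cocycle => fv fA f0; have := fA a a b; rewrite aa0 faa (f0 b).1.
by case: (fv a b) => ->; rewrite ?mulr1 ?mul1r ?mulN1r ?mulrN1; lia.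
Qed.

End NormalizedCocycle.

(** * Indexed elements of the group and the Hadamard criterion *)

HB.instance Definition _ t := Finite.on (grp t).

Section Elements.
Variable t : nat.
Hypothesis t_gt1 : (1 < t)%N.

Lemma elt1 : elt t 1 = 0. Proof. by []. Qed.

Lemma elt_inj : {in [pred i | 0 < i <= 4 * t]%N &, injective (elt t)}.
Proof.
move=> i j; rewrite !inE => i_le j_le [/(congr1 val) + /(congr1 val) + /(congr1 val)].
rewrite /= !val_Zp_nat // !(@modn_small _ t); lia.
Qed.

Lemma elt_bij : bijective (fun i : 'I_(t * 4) => elt t i.+1).
Proof.
apply: inj_card_bij => [i j /elt_inj|].
  have := ltn_ord i; have := ltn_ord j; rewrite !inE => ? ? eq_ij.
  by apply/val_inj/succn_inj/eq_ij; lia.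
by rewrite /grp !card_prod !card_ord Zp_cast.
Qed.

(** The bound is a variable because matrix indices range below [t * 4] and polynomial sums below
    [4 * t]. *)
Lemma sum_elt (V : nmodType) (F : grp t -> V) n : n = (t * 4)%N ->
  \sum_(i < n) F (elt t i.+1) = \sum_a F a.
Proof. by move=> ->; rewrite [RHS](reindex _ (onW_bij _ elt_bij)). Qed.

Lemma elt_surj a : exists2 i, (i < t * 4)%N & a = elt t i.+1.
Proof. by have [g _ gK] := elt_bij; exists (g a); rewrite ?gK ?ltn_ord. Qed.

Lemma prod_idx_bound s c : (0 < prod_idx t s c <= 4 * t)%N.
Proof.
rewrite /prod_idx.
have := ltn_pmod ((s - 1) %/ 4 + (c - 1) %/ 4) (ltnW t_gt1); lia.
Qed.

Lemma elt_prod_idx s c : (0 < s)%N -> (0 < c)%N ->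
  elt t (prod_idx t s c) = elt t s + elt t c.
Proof.
move=> s_gt0 c_gt0; rewrite /prod_idx.
set A := (((s - 1) %/ 4 + (c - 1) %/ 4) %% t)%N.
set B := ((((s - 1) %% 4) %/ 2 + ((c - 1) %% 4) %/ 2) %% 2)%N.
set C := ((s + c) %% 2)%N; rewrite /elt.
have -> : ((1 + 4 * A + 2 * B + C - 1) %/ 4 = A)%N by lia.
have -> : ((1 + 4 * A + 2 * B + C - 1) %% 4 %/ 2 = B)%N by lia.
have -> : ((1 + 4 * A + 2 * B + C - 1) %% 2 = C)%N by lia.
(* Passing to zero-based indices lowers s + c by 2, which keeps its parity. *)
have CE : C = (((s - 1) %% 2 + (c - 1) %% 2) %% 2)%N by lia.
by rewrite CE /A /B !Zp_nat_mod // !natrD !Zp_nat_mod //.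
Qed.

(** For odd t every element of Z_t is a double, so [F] is a square, hence 1, on Z_t. The two given
    elements have Z_2^2 components (1, 0) and (1, 1), which generate Z_2^2. *)
Lemma sign_morphism_trivial (F : grp t -> int) : odd t ->
  (forall a, F a * F a = 1) -> {morph F : a b / a + b >-> a * b} ->
  F (elt t (4 * t - 1)) = 1 -> F (elt t (4 * t)) = 1 -> forall a, F a = 1.
Proof.
move=> t_odd FF FD.
have F1 (a : 'Z_t) : F (a, (0, 0)) = 1.
  (* (t + 1) / 2 is the inverse of 2 modulo t. *)
  suff -> : (a, (0, 0)) = (a *+ (t.+1)./2, (0, 0)) + (a *+ (t.+1)./2, (0, 0)) :> grp t.
    by rewrite FD FF.
  congr (_, _); last exact/esym/(addr0 (0 : 'Z_2 * 'Z_2)).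
  rewrite /= -mulrnDr.
  have -> : ((t.+1)./2 + (t.+1)./2 = t.+1)%N by lia.
  by rewrite mulrS -mulr_natr -[t%:R]Zp_nat_mod // modnn mulr0 addr0.
have F2 (a : 'Z_t) u : F (a, u) = F (0, u).
  rewrite -[RHS]mul1r -(F1 a) -FD; congr F.
  by congr (_, _); rewrite ?addr0 ?(add0r (u : 'Z_2 * 'Z_2)).
rewrite /elt !F2.
have -> : ((4 * t - 1 - 1) %% 4 %/ 2 = 1)%N by lia.
have -> : ((4 * t - 1 - 1) %% 2 = 0)%N by lia.
have -> : ((4 * t - 1) %% 4 %/ 2 = 1)%N by lia.
have -> : ((4 * t - 1) %% 2 = 1)%N by lia.
move=> F10 F11 [a [u v]]; rewrite F2.
have F01 : F (0, (0, 1)) = 1.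
  have := FD (0, (1, 0)) (0, (1, 1)); rewrite F10 F11 mulr1 => <-.
  by congr (F (_, (_, _))); exact/val_inj.
have Z2 (w : 'Z_2) : w = 0 \/ w = 1.
  by case: w => [[|[|[]]] //] ?; [left|right]; apply: val_inj.
by case: (Z2 u) => ->; case: (Z2 v) => ->.
Qed.

Variable f : grp t -> grp t -> int.
Hypothesis f_cocycle : normalized_cocycle f.

Lemma cocyclic_hadamardP :
  is_hadamard (cocyclic_mx f) <-> forall a, a != 0 -> \sum_b f a b = 0.
Proof.
have dotE i j : (cocyclic_mx f *m (cocyclic_mx f)^T) i j =
    \sum_c f (elt t i.+1) c * f (elt t j.+1) c.
  rewrite mxE -(sum_elt _ (erefl (t * 4)%N)); apply: eq_bigr => c _; by rewrite !mxE.
split=> [[_ /matrixP fH] a a_neq0|f0].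
  have [i lt_i aE] := elt_surj a.
  have t4_gt0 : (0 < t * 4)%N by lia.
  (* The row of 0 consists of ones, so the inner product with it is the row sum. *)
  have := fH (Ordinal lt_i) (Ordinal t4_gt0); rewrite dotE !mxE /= -aE elt1.
  case: i => [|i] in lt_i aE *; first by rewrite aE elt1 eqxx in a_neq0.
  rewrite -val_eqE /= mulr0n => fa0; rewrite -[RHS]fa0.
  by apply: eq_bigr => b _; case: f_cocycle => _ _ /(_ b) [-> _]; rewrite mulr1.
split=> [i j|]; first by rewrite mxE; case: f_cocycle.
apply/matrixP => i j; rewrite dotE mxE.
have [->|neq_ij] := eqVneq i j.
  under eq_bigr do rewrite cocycle_mulK //.
  by rewrite sumr_const -sum1_card -(sum_elt (fun=> 1%N) (erefl (t * 4)%N)) sum1_card card_ord mulr1n.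
rewrite cocycle_row_dot // f0 ?mulr0 // subr_eq0; apply: contra neq_ij => /eqP.
by move/(bij_inj elt_bij)=> ->.
Qed.

(* The rows 2, 3, 4 belong to elements of order two, and negation maps the rows
   after 2t + 2 to the rows 5, .., 2t + 2. *)
Lemma cocycle_rows_half : odd t ->
  (forall i, (0 < i < 4)%N -> f (elt t i.+1) (elt t i.+1) = -1) ->
  (forall l, (0 < l <= 2 * t - 2)%N -> \sum_b f (elt t (l + 4)) b = 0) ->
  forall a, a != 0 -> \sum_b f a b = 0.
Proof.
move=> t_odd f_diag f_rows a a_neq0.
(* Here i is zero-based, so it corresponds to l = i - 3. *)
have half i : (4 <= i < 2 * t + 2)%N -> \sum_b f (elt t i.+1) b = 0.
  by move=> ?; rewrite (_ : i.+1 = i - 3 + 4)%N; [apply: f_rows|]; lia.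
have [i lt_i aE] := elt_surj a.
have i_gt0 : (0 < i)%N by case: i aE a_neq0 {lt_i} => // ->; rewrite elt1 eqxx.
have [i_lt4|i_ge4] := ltnP i 4.
  apply: cocycle_row_sum_order2 => //; last by rewrite aE f_diag ?i_gt0.
  rewrite aE -elt_prod_idx // -elt1; congr elt; rewrite /prod_idx.
  have -> : ((i.+1 - 1) %/ 4 + (i.+1 - 1) %/ 4 = 0)%N by lia.
  rewrite mod0n; lia.
have [i_lt|i_ge] := ltnP i (2 * t + 2); first by rewrite aE half ?i_ge4.
have [j lt_j NaE] := elt_surj (- a).
have := cocycle_row_sumN f_cocycle a; rewrite NaE half.
  by move/esym/eqP; rewrite mulf_eq0 (negPf (cocycle_neq0 f_cocycle _ _)) => /eqP.
(* The Z_t components i / 4 and j / 4 add up to a multiple of t, which can only be t. As 2t + 2 is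
   divisible by 4 for odd t, i >= 2t + 2 forces 4 <= j < 2t + 2. *)
have : elt t i.+1 + elt t j.+1 = 0 by rewrite -aE -NaE subrr.
move=> /(congr1 (fun b : grp t => b.1)) /= /(congr1 val).
rewrite -natrD /= val_Zp_nat // !subn1 /= => sum_mod.
have /dvdnP[[|[|k]] sumE] : (t %| i %/ 4 + j %/ 4)%N by rewrite /dvdn sum_mod.
- lia.
- lia.
- have : (2 * t <= k.+2 * t)%N by rewrite leq_mul2r orbT.
  lia.
Qed.

End Elements.

(** * Ideals containing the polynomials X_i^2 - X_i *)

Lemma mem_ideal_gen (R : comNzRingType) (I : finType) (g : I -> R) i :
  g i \in ideal_gen g.
Proof.
apply/asboolP; exists (fun j => (j == i)%:R).
by rewrite (bigD1 i) //= eqxx mul1r big1 ?addr0 // => j /negPf ->; rewrite mul0r.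
Qed.

Section BooleanIdeal.
Local Open Scope quotient_scope.
Variables (K : fieldType) (n : nat).
Implicit Types (x y : {ffun 'I_n -> bool}) (p : {mpoly K[n]}).

Definition bool_eval x p : K := p.@[fun i => (x i)%:R].

Definition indicator_poly x : {mpoly K[n]} :=
  \prod_(i < n) (if x i then 'X_i else 1 - 'X_i).

Lemma bool_eval_indicator x y :
  bool_eval x (indicator_poly y) = (x == y)%:R.
Proof.
rewrite /bool_eval rmorph_prod /=; have [<-|neq_xy] := eqVneq x y.
  rewrite big1 // => i _; case xi: (x i).
    by rewrite mevalXU /= xi.
  by rewrite mevalB meval1 mevalXU /= xi subr0.
have [i neq_i] : exists i, x i != y i.
  apply/existsP; rewrite -negb_forall; apply: contra neq_xy => /forallP eq_xy.
  by apply/eqP/ffunP => i; apply/eqP.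
rewrite (bigD1 i) //=; case: (y i) neq_i; case xi: (x i) => // _.
  by rewrite mevalXU /= xi mul0r.
by rewrite mevalB meval1 mevalXU /= xi subrr mul0r.
Qed.

(** This is the expansion of the product over i of X_i + (1 - X_i). *)
Lemma sum_indicator_poly : \sum_x indicator_poly x = 1.
Proof.
rewrite -(bigA_distr_bigA (fun i (b : bool) => if b then 'X_i else 1 - 'X_i)) big1 //.
by move=> i _; rewrite big_bool /= addrC subrK.
Qed.

Variable J : ideal {mpoly K[n]}.
Hypothesis J_bool : forall i : 'I_n, 'X_i ^+ 2 - 'X_i \in J.

(** The polynomials q with (q - q(x)) e_x in [J] contain 1 and are closed under products and linear
    combinations, so it suffices to treat the variables. *)
Lemma indicator_poly_mod x p :
  p * indicator_poly x - bool_eval x p *: indicator_poly x \in J.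
Proof.
have eqE q : q * indicator_poly x - bool_eval x q *: indicator_poly x =
    (q - (bool_eval x q)%:MP) * indicator_poly x by rewrite mulrBl mul_mpolyC.
rewrite eqE.
pose P q := (q - (bool_eval x q)%:MP) * indicator_poly x \in J.
have P1 : P 1 by rewrite /P /bool_eval meval1 subrr mul0r rpred0.
have PM q r : P q -> P r -> P (q * r).
  rewrite /P /bool_eval => Pq Pr; rewrite mevalM mpolyCM.
  set a := q.@[_] in Pq *; set b := r.@[_] in Pr *.
  have -> : (q * r - a%:MP * b%:MP) * indicator_poly x =
     r * ((q - a%:MP) * indicator_poly x) + a%:MP * ((r - b%:MP) * indicator_poly x).
    by ring.
  by apply: rpredD; apply: idealMl.
(* The factor of e_x at i is X_i or 1 - X_i; multiplied by X_i - x_i it gives X_i^2 - X_i up to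
   sign. *)
have PX (i : 'I_n) : P 'X_i.
  rewrite /P /bool_eval mevalXU /indicator_poly (bigD1 i) //= mulrA mulrC.
  apply: idealMl; case: (x i).
    by rewrite mulrBl -expr2 mul1r.
  rewrite mpolyC0 subr0 mulrBr mulr1 -expr2 -opprB rpredN; exact: J_bool.
rewrite [p]mpolyE; elim/big_rec: _ => [|m q _ Pq].
  by rewrite /bool_eval meval0 subrr mul0r rpred0.
have Pm : P 'X_[m].
  rewrite mpolyXE_id; elim/big_ind: _ => // i _.
  by elim: (m i) => [|k IH]; rewrite ?expr0 // exprS; apply: PM.
rewrite /bool_eval mevalD mevalZ mpolyCD mpolyCM.
have -> : (p@_m *: 'X_[m] + q - ((p@_m)%:MP * ('X_[m].@[fun i => (x i)%:R])%:MP +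
     (q.@[fun i => (x i)%:R])%:MP)) * indicator_poly x =
   (p@_m)%:MP * (('X_[m] - (bool_eval x 'X_[m])%:MP) * indicator_poly x) +
   (q - (bool_eval x q)%:MP) * indicator_poly x.
  by rewrite -mul_mpolyC /bool_eval; ring.
by apply: rpredD => //; apply: idealMl.
Qed.

Definition bool_zeros : {set {ffun 'I_n -> bool}} :=
  [set x | `[< forall p, p \in J -> bool_eval x p = 0 >]].

(** Some p in [J] has p(x) nonzero; both p e_x and p e_x - p(x) e_x lie in [J], and p(x) is
    invertible. *)
Lemma indicator_poly_ideal x : x \notin bool_zeros -> indicator_poly x \in J.
Proof.
rewrite inE => /asboolP /existsNP[p /not_implyP[pJ /eqP px]].
have : bool_eval x p *: indicator_poly x \in J.
  by rewrite -(rpredBl _ (_ : p * indicator_poly x \in J)) ?indicator_poly_mod // mulrC idealMl.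
move=> /(idealMl ((bool_eval x p)^-1)%:MP).
by rewrite mul_mpolyC scalerA mulVf // scale1r.
Qed.

Lemma has_dim_quot_bool_zeros : has_dim (quot_module J) #|bool_zeros|.
Proof.
pose e (i : 'I_#|bool_zeros|) : quot_module J :=
  \pi_(Quotient.quot J) (indicator_poly (enum_val i)).
exists e => v; have [p ->] := quot_piP v.
have sumE (c : {ffun 'I_#|bool_zeros| -> K}) : \sum_i c i *: e i =
    \pi_(Quotient.quot J) (\sum_i c i *: indicator_poly (enum_val i)).
  rewrite (raddf_sum \pi_(Quotient.quot J)).
  by apply: eq_bigr => i _; exact: quot_scale_pi.
exists [ffun i => bool_eval (enum_val i) p]; split.
  rewrite sumE; apply/eqP; rewrite -Quotient.idealrBE.
  rewrite -{1}[p]mulr1 -sum_indicator_poly mulr_sumr.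
  rewrite (bigID (mem bool_zeros)) /= addrC -addrA rpredD //.
    by apply: rpred_sum => x ?; rewrite idealMl ?indicator_poly_ideal.
  rewrite big_enum_val -sumrB rpred_sum // => i _.
  by rewrite ffunE indicator_poly_mod.
move=> c; rewrite sumE => /eqP; rewrite -Quotient.idealrBE => pcJ.
apply/ffunP => i; rewrite ffunE.
(* Uniqueness: evaluation at the i-th zero of [J] isolates the coefficient [c i]. *)
have := enum_valP i; rewrite inE => /asboolP /(_ _ pcJ) /eqP.
rewrite /bool_eval mevalB subr_eq0 => /eqP ->.
rewrite raddf_sum (bigD1 i) //= mevalZ.
rewrite [X in _ * X]bool_eval_indicator eqxx mulr1 big1 ?addr0 // => j neq_ji.
rewrite mevalZ [X in _ * X]bool_eval_indicator (inj_eq enum_val_inj).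
by rewrite eq_sym (negPf neq_ji) mulr0.
Qed.

End BooleanIdeal.

(** * From rational 0/1 zeros to the variety over [algC] *)

Section BooleanVariety.
Variable n : nat.
Implicit Types (x : {ffun 'I_n -> bool}) (p : {mpoly rat[n]}).

Lemma map_mpoly_bool_point x p :
  (map_mpoly (ratr : rat -> algC) p).@[bool_point x] = ratr (bool_eval x p).
Proof.
elim/mpolyind: p => [|c m p _ _ IH]; first by rewrite raddf0 /bool_eval !meval0 rmorph0.
rewrite /bool_eval in IH *; rewrite raddfD /= mevalD IH mevalD rmorphD; congr (_ + _).
rewrite map_mpolyZ mevalZ map_mpolyX !mevalX mevalZ mevalX rmorphM rmorph_prod /=.
by congr (_ * _); apply: eq_bigr => i _; rewrite rmorphXn /= rmorph_nat.
Qed.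

Lemma variety_bool_zeros (J : ideal {mpoly rat[n]}) :
  (forall i : 'I_n, 'X_i ^+ 2 - 'X_i \in J) ->
  variety J = [set bool_point x | x in [set x | x \in bool_zeros J]].
Proof.
move=> J_bool; apply/seteqP; split=> [v vJ|_ [x + <-] p pJ]; last first.
  rewrite /= inE => /asboolP /(_ _ pJ) xp.
  by rewrite map_mpoly_bool_point xp rmorph0.
have v01 i : v i = (v i == 1)%:R.
  have /eqP := vJ _ (J_bool i).
  rewrite rmorphB rmorphXn /= map_mpolyX mevalB mevalM mevalXU.
  rewrite -{3}[v i]mulr1 -mulrBr mulf_eq0 subr_eq0.
  by case/orP => /eqP ->; rewrite ?eqxx // eq_sym oner_eq0.
pose x : {ffun 'I_n -> bool} := [ffun i => v i == 1].
have vE : bool_point x = v.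
  by apply/funext => i; rewrite /bool_point ffunE -v01.
exists x => //=; rewrite inE; apply/asboolP => p pJ.
by have /eqP := vJ _ pJ; rewrite -vE map_mpoly_bool_point fmorph_eq0 => /eqP.
Qed.

(** The generators X_i^2 - X_i vanish at every 0/1 point, so only the [g k] impose conditions. *)
Lemma mem_bool_zeros (I : finType) (g : I -> {mpoly rat[n]}) x :
  (x \in bool_zeros (ideal_add
     (ideal_gen (fun i : 'I_n => 'X_i ^+ 2 - 'X_i)) (ideal_gen g))) <->
  forall k, bool_eval x (g k) = 0.
Proof.
rewrite inE; split=> [/asboolP xJ k|xg].
  apply: xJ; apply/asboolP; exists 0, (g k); rewrite rpred0 add0r; split=> //.
  exact: mem_ideal_gen.
apply/asboolP => _ /asboolP[_ [_ [/asboolP[c ->] /asboolP[d ->] ->]]].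
rewrite /bool_eval mevalD !raddf_sum /= !big1 ?addr0 // => i _.
  by rewrite mevalM [X in _ * X]xg mulr0.
by rewrite mevalM mevalB mevalM !mevalXU -natrM mulnb andbb subrr mulr0.
Qed.

End BooleanVariety.

(** * The cocycles rho multiplied by coboundaries *)

Section SignCoboundary.
Variable t : nat.
Hypothesis t_gt1 : (1 < t)%N.
Implicit Types (x y : {ffun 'I_(4 * t - 3) -> bool}) (a b : grp t).

(** The cochain whose coboundary is the product of elementary coboundaries in [psi]. *)
Definition delta_prod x a : int := \prod_(i < 4 * t - 3) delta (elt t i.+2) a ^+ x i.

Lemma delta_prod_mulK x a : delta_prod x a * delta_prod x a = 1.
Proof.
rewrite -big_split big1 // => i _ /=.
by rewrite /delta; case: eqP => _; case: (x i).
Qed.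

Lemma delta_prod_neq0 x a : delta_prod x a != 0.
Proof. by apply/eqP => D0; have := delta_prod_mulK x a; rewrite D0. Qed.

Lemma delta_elt i h : (i < 4 * t - 3)%N -> (0 < h <= 4 * t)%N ->
  delta (elt t i.+2) (elt t h) = if h == i.+2 then -1 else 1.
Proof.
move=> i_lt h_le; rewrite /delta; have [->|neq_h] := eqVneq h i.+2.
  by rewrite eqxx.
case: eqP => // /(elt_inj t_gt1) hE; rewrite hE ?eqxx // in neq_h; rewrite inE; lia.
Qed.

Lemma delta_prod_elt x (i : 'I_(4 * t - 3)) :
  delta_prod x (elt t i.+2) = (-1) ^+ x i.
Proof.
have i_lt := ltn_ord i.
rewrite /delta_prod (bigD1 i) //= delta_elt // ?eqxx; last by lia.
rewrite big1 ?mulr1 // => j neq_ji.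
rewrite delta_elt //; last by lia.
by rewrite !eqSS eq_sym (inj_eq val_inj) (negPf neq_ji) expr1n.
Qed.

(** The indices concerned are 1, 4t - 1 and 4t, where none of the delta functions in the product
    takes the value -1. *)
Lemma delta_prod_elt1 x h : (0 < h <= 4 * t)%N -> chi t h = 0%N ->
  delta_prod x (elt t h) = 1.
Proof.
rewrite /chi => h_le chi_h; rewrite /delta_prod big1 // => i _.
have i_lt := ltn_ord i; rewrite delta_elt //.
by have [hE|_] := eqVneq; [move: chi_h; rewrite hE; lia | rewrite expr1n].
Qed.

(** For a bit x, 1 - 2x = (-1)^x. *)
Lemma delta_prod_eval x h : (0 < h <= 4 * t)%N ->
  bool_eval x ((1 - 2 * xvar t (h - 1)) ^+ chi t h) = (delta_prod x (elt t h))%:~R.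
Proof.
move=> h_le; have [chi1|] := boolP (1 < h <= 4 * t - 2)%N; last first.
  move=> /negPf chi0; have chi_h : chi t h = 0%N by rewrite /chi chi0.
  by rewrite delta_prod_elt1 // chi_h /bool_eval meval1.
have h_lt : (h - 2 < 4 * t - 3)%N by lia.
have -> : h = (Ordinal h_lt).+2 by rewrite /=; lia.
set i := Ordinal h_lt; rewrite delta_prod_elt.
have -> : chi t i.+2 = 1%N by rewrite /chi /i /=; lia.
rewrite /xvar (_ : i.+2 - 1 - 1 = i)%N; last by lia.
rewrite valK /bool_eval rmorphB rmorphM /= mevalXU meval1.
rewrite (_ : 2.@[_] = 2) ?rmorph_nat //.
by case: (x i); rewrite /= ?mulr1 ?mulr0 ?subr0 // opprD addrA subrr add0r.
Qed.

Variable rho : grp t -> grp t -> int.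
Hypothesis rho_cocycle : normalized_cocycle rho.
Hypothesis rhoE : cocyclic_mx rho = M_rho t.

Lemma psi_delta_prod x a b :
  psi rho x a b = rho a b * (delta_prod x a * delta_prod x b * delta_prod x (a + b)).
Proof.
rewrite /psi -!big_split; congr (_ * _); apply: eq_bigr => i _ /=.
by rewrite /coboundary !exprMn.
Qed.

Lemma psi_cocycle x : normalized_cocycle (psi rho x).
Proof.
case: rho_cocycle => rho_sign rhoA rho0.
have D0 : delta_prod x 0 = 1.
  by rewrite -(elt1 t) delta_prod_elt1 //; lia.
have Dsign a : delta_prod x a = 1 \/ delta_prod x a = -1.
  have /eqP := delta_prod_mulK x a.
  by rewrite -expr2 sqrf_eq1 => /orP[] /eqP; [left|right].
split=> [a b|a b c|a]; rewrite !psi_delta_prod.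
- case: (rho_sign a b) => ->; case: (Dsign a) => ->; case: (Dsign b) => ->;
  case: (Dsign (a + b)) => ->; by [left | right].
- set A := delta_prod x a; set B := delta_prod x b; set C := delta_prod x c.
  rewrite addrA; set E := delta_prod x (a + b + c).
  have -> : rho a b * (A * B * delta_prod x (a + b)) *
      (rho (a + b) c * (delta_prod x (a + b) * C * E)) =
    (rho a b * rho (a + b) c) * (A * B * C * E) *
      (delta_prod x (a + b) * delta_prod x (a + b)) by ring.
  (* The square at a + b on the left is traded for the one at b + c that the right side contains. *)
  rewrite rhoA delta_prod_mulK -(delta_prod_mulK x (b + c)); ring.
- rewrite add0r addr0 D0 !(rho0 a).1 !(rho0 a).2 !mul1r mulr1.
  by rewrite delta_prod_mulK.
Qed.

Lemma rho_diag i : (0 < i < 4)%N -> rho (elt t i.+1) (elt t i.+1) = -1.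
Proof.
move=> i_lt; have i_lt4 : (i < 4)%N by lia.
have := congr1 (fun M : 'M_(t * 4) =>
  M (mxtens_index (Ordinal (ltnW t_gt1), Ordinal i_lt4))
    (mxtens_index (Ordinal (ltnW t_gt1), Ordinal i_lt4))) rhoE.
rewrite mxE tensmxE !mxE /= mul0n add0n => ->.
by case: i i_lt {i_lt4} => [|[|[|[|]]]].
Qed.

(** At (a, a) with a + a = 0 the coboundary factor is D(a)^2 D(0) = 1, where D is [delta_prod x], so
    the diagonal entry of [rho] is unchanged. *)
Lemma psi_diag x i : (0 < i < 4)%N -> psi rho x (elt t i.+1) (elt t i.+1) = -1.
Proof.
move=> i_lt; rewrite psi_delta_prod rho_diag // delta_prod_mulK mul1r.
rewrite -elt_prod_idx // (_ : prod_idx t i.+1 i.+1 = 1%N).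
  by rewrite delta_prod_elt1 //; lia.
rewrite /prod_idx (_ : (i.+1 - 1) %/ 4 + (i.+1 - 1) %/ 4 = 0)%N ?mod0n; lia.
Qed.

(** The factor [delta_prod x (elt t (l + 4))] is constant along the row and is left out of [s_poly],
    hence the sign in front of the row sum. *)
Lemma s_poly_sum_eval x l : (0 < l)%N ->
  bool_eval x (\sum_(1 <= h < (4 * t).+1) s_poly rho l h) =
  (delta_prod x (elt t (l + 4)) * \sum_b psi rho x (elt t (l + 4)) b)%:~R.
Proof.
move=> l_gt0; rewrite big_add1 /= big_mkord /bool_eval rmorph_sum /=.
rewrite -(sum_elt t_gt1 _ (mulnC 4 t)) mulr_sumr rmorph_sum; apply: eq_bigr => i _ /=.
have i_lt := ltn_ord i.
rewrite /s_poly !mevalM [X in _ * X * _]delta_prod_eval; last by lia.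
rewrite [X in _ * X]delta_prod_eval ?prod_idx_bound // elt_prod_idx //; last by lia.
rewrite psi_delta_prod rmorph_int -!rmorphM; congr (_%:~R).
set a := elt t (l + 4); set b := elt t i.+1; rewrite -[LHS]mul1r -(delta_prod_mulK x a).
ring.
Qed.

Lemma mem_zeros_ideal_J x : odd t ->
  (x \in bool_zeros (ideal_J rho)) <-> is_hadamard (cocyclic_mx (psi rho x)).
Proof.
move=> t_odd; have psi_nc := psi_cocycle x.
apply: (iff_trans (mem_bool_zeros _ _)).
apply: (iff_trans _ (iff_sym (cocyclic_hadamardP t_gt1 psi_nc))).
split=> [row0|row0 k].
  apply: cocycle_rows_half => // [|l l_le]; first exact: psi_diag.
  have l_lt : (l.-1 < 2 * t - 2)%N by lia.
  have := row0 (Ordinal l_lt); rewrite s_poly_sum_eval // prednK; last by lia.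
  by move/eqP; rewrite intr_eq0 mulf_eq0 (negPf (delta_prod_neq0 _ _)) => /eqP.
rewrite s_poly_sum_eval // row0 ?mulr0 //; have k_lt := ltn_ord k.
rewrite -(elt1 t); apply/eqP => /(elt_inj t_gt1); rewrite !inE => eq1.
by have := eq1 _ _; lia.
Qed.

Lemma form_mxE x : form_mx x = cocyclic_mx (psi rho x).
Proof.
apply/matrixP => i j; rewrite /form_mx -rhoE !mxE; congr (_ * _).
rewrite (big_morph (fun M : 'M[int]_(t * 4) => M i j) (id1 := 1) (op1 := *%R)) ?mxE //.
  by apply: eq_bigr => k _; rewrite !mxE.
by move=> M N; rewrite mxE.
Qed.

Lemma form_mx_inj : odd t -> injective (@form_mx t).
Proof.
move=> t_odd x y; rewrite !form_mxE => /matrixP eq_xy.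
have D_eq a b : delta_prod x a * delta_prod x b * delta_prod x (a + b) =
    delta_prod y a * delta_prod y b * delta_prod y (a + b).
  have [i i_lt ->] := elt_surj t_gt1 a; have [j j_lt ->] := elt_surj t_gt1 b.
  have := eq_xy (Ordinal i_lt) (Ordinal j_lt); rewrite !mxE !psi_delta_prod.
  exact/mulfI/cocycle_neq0.
(* Signs being their own inverses, [F] is the quotient of two cochains with equal coboundaries,
   hence a morphism. *)
pose F a := delta_prod x a * delta_prod y a.
have FF a : F a * F a = 1 by rewrite /F mulrACA !delta_prod_mulK.
have FD : {morph F : a b / a + b >-> a * b}.
  move=> a b; have F1 : F a * F b * F (a + b) = 1.
    have -> : F a * F b * F (a + b) =
      (delta_prod x a * delta_prod x b * delta_prod x (a + b)) *
      (delta_prod y a * delta_prod y b * delta_prod y (a + b)) by rewrite /F; ring.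
    by rewrite -D_eq mulrACA [X in X * _]mulrACA !delta_prod_mulK.
  by rewrite -[RHS]mulr1 -(FF (a + b)) mulrA F1 mul1r.
have F_out h : (0 < h <= 4 * t)%N -> chi t h = 0%N -> F (elt t h) = 1.
  by move=> h_le chi_h; rewrite /F !delta_prod_elt1.
have F1 a : F a = 1.
  apply: sign_morphism_trivial => //; apply: F_out; rewrite /chi; lia.
apply/ffunP => i; have := F1 (elt t i.+2); rewrite /F !delta_prod_elt.
by case: (x i) (y i) => [] [].
Qed.

(** Presenting the set as the image of a finite set gives access to its cardinality. *)
Lemma cocyclic_hadamard_formE : odd t ->
  @cocyclic_hadamard_form t =
    [set` [fset form_mx x | x in bool_zeros (ideal_J rho)]%fset].
Proof.
move=> t_odd; apply/seteqP; split=> M /=.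
  move=> [_ M_had [x Mx]]; apply/imfsetP; exists x => //=.
  by apply/mem_zeros_ideal_J => //; rewrite -form_mxE -Mx.
move=> /imfsetP[x /= /mem_zeros_ideal_J -/(_ t_odd) x_had ->]; split.
- by exists (psi rho x); [exact: psi_cocycle | exact: form_mxE].
- by rewrite form_mxE.
- by exists x.
Qed.

End SignCoboundary.

Theorem theorem5 (t : nat) (t_gt1 : (1 < t)%N) (t_odd : odd t)
    (rho : grp t -> grp t -> int)
    (rho_cocycle : normalized_cocycle rho)
    (rhoE : cocyclic_mx rho = M_rho t) :
  let J := ideal_J rho in
  let H := @cocyclic_hadamard_form t in
  [/\ zero_dimensional J,
      variety J =
        [set @bool_point (4 * t - 3) x | x in
           [set x | is_hadamard (cocyclic_mx (psi rho x))]],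
      exists2 phi : ('I_(4 * t - 3) -> algC) -> 'M[int]_(t * 4),
        set_bij (variety J) H phi
        & forall x : {ffun 'I_(4 * t - 3) -> bool},
            variety J (bool_point x) -> phi (bool_point x) = form_mx x
    & finite_set H /\ has_dim (quot_module J) #|` fset_set H|].
Proof.
move=> J H.
have J_bool (i : 'I_(4 * t - 3)) : 'X_i ^+ 2 - 'X_i \in J.
  apply/asboolP; exists ('X_i ^+ 2 - 'X_i), 0; rewrite rpred0 addr0; split=> //.
  exact: mem_ideal_gen.
have zerosE x := mem_zeros_ideal_J t_gt1 rho_cocycle rhoE x t_odd.
have JE := variety_bool_zeros J_bool.
have HE : H = _ := cocyclic_hadamard_formE t_gt1 rho_cocycle rhoE t_odd.
(* Testing against 1 recovers the bits of a 0/1 point; the values off the variety are arbitrary. *)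
pose phi (v : 'I_(4 * t - 3) -> algC) := form_mx [ffun i => v i == 1].
have phiE x : phi (bool_point x) = form_mx x.
  congr form_mx; apply/ffunP => i; rewrite ffunE /bool_point.
  by case: (x i); rewrite ?eqxx // eq_sym oner_eq0.
split.
- by rewrite /zero_dimensional JE; apply: finite_image; exact: finite_finset.
- by rewrite JE; congr (image _ _); apply/seteqP; split=> x /zerosE.
- exists phi => //; rewrite JE HE; split.
  + by move=> _ [x xJ <-]; rewrite phiE /=; apply/imfsetP; exists x.
  + move=> _ _ /set_mem[x _ <-] /set_mem[y _ <-].
    by rewrite !phiE => /(form_mx_inj t_gt1 rho_cocycle rhoE t_odd) ->.
  + by move=> M /= /imfsetP[x /= xJ ->]; exists (bool_point x); [exists x|].
- rewrite HE; split; first exact: finite_fset.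
  rewrite set_fsetK card_in_imfset /=.
    by rewrite -cardE; exact: has_dim_quot_bool_zeros.
  by move=> x y _ _; apply: (form_mx_inj t_gt1 rho_cocycle rhoE t_odd).
Qed.
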